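(* Let $\omega\in[0,1]$ and let $A\in\mathbb{C}^{m\times m}$, $B\in\mathbb{C}^{m\times n}$, $C\in\mathbb{C}^{n\times m}$, $D\in\mathbb{C}^{n\times n}$ be such that $XCX-XD-AX+B=0$ is in class $\mathbb{H}^\omega$, and suppose that $Q_\omega\mathbf{1}>0$, where $Q=\begin{pmatrix}D&-C\\-B&A\end{pmatrix}$. Let $\Phi$ and $\Psi$ be the extremal solutions of $XCX-XD-AX+B=0$ and of its dual $YBY-YA-DY+C=0$, respectively. Apply SDA to $XCX-XD-AX+B=0$ with $\alpha=tz_\omega^\bot$, where $z_\omega^\bot=\omega+\mathrm{j}(1-\omega)$. If $t>\max_{i=1,\dots,m+n}\tau_{\omega,i}$, where $$\tau_{\omega,i}=\frac{1}{\varpi}\sqrt{q_i\left(\omega\mathrm{Re}([Q]_{ii})+(1-\omega)\mathrm{Im}([Q]_{ii})+\frac{(\omega\mathrm{Im}([Q]_{ii})-(1-\omega)\mathrm{Re}([Q]_{ii}))^2}{\omega\mathrm{Re}([Q]_{ii})+(1-\omega)\mathrm{Im}([Q]_{ii})-q_i}\right)},\quad i=1,\dots,m+n,$$ $\varpi=\omega^2+(1-\omega)^2$ and $q_i=\sum_{j\ne i}|[Q]_{ij}|$, then the sequences $\{E_k\},\{F_k\},\{H_k\},\{G_k\}$ are well-defined and $\{H_k\}$ and $\{G_k\}$ converge quadratically to $\Phi$ and $\Psi$, respectively.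
   Context: For a complex square matrix $M$ and a real $\omega\in[0,1]$, the $\omega$-comparison matrix $M_\omega$ is the real matrix with entries $[M_\omega]_{ii}=\omega\,\mathrm{Re}([M]_{ii})+(1-\omega)\,\mathrm{Im}([M]_{ii})$ and $[M_\omega]_{ij}=-|[M]_{ij}|$ for $i\ne j$. A real square matrix $M$ is a nonsingular M-matrix if all its off-diagonal entries are nonpositive and $Mu>0$ (entrywise) for some vector $u>0$. $\mathbf{1}$ is the all-ones column vector; $\mathrm{j}$ is the imaginary unit. The equation is in class $\mathbb{H}^\omega$ if $Q_\omega$ is a nonsingular M-matrix. Extremal solutions: $\Phi$ is the unique solution of $XCX-XD-AX+B=0$ such that every eigenvalue $\lambda$ of $D-C\Phi$ satisfies $\omega\,\mathrm{Re}(\lambda)+(1-\omega)\,\mathrm{Im}(\lambda)>0$; $\Psi$ is the unique solution of $YBY-YA-DY+C=0$ such that every eigenvalue $\lambda$ of $A-B\Psi$ satisfies the same inequality (both exist and are unique under these hypotheses). SDA with parameter $\alpha$ is the following algorithm with $\beta=\alpha$: put $A_\beta=A+\beta I$, $D_\alpha=D+\alpha I$, $W_{\alpha\beta}=A_\beta-BD_\alpha^{-1}C$, $V_{\alpha\beta}=D_\alpha-CA_\beta^{-1}B$, and $$E_0=I-(\alpha+\beta)V_{\alpha\beta}^{-1},\ F_0=I-(\alpha+\beta)W_{\alpha\beta}^{-1},\ G_0=(\alpha+\beta)D_\alpha^{-1}CW_{\alpha\beta}^{-1},\ H_0=(\alpha+\beta)W_{\alpha\beta}^{-1}BD_\alpha^{-1};$$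 for $k\ge0$, $$E_{k+1}=E_k(I-G_kH_k)^{-1}E_k,\quad F_{k+1}=F_k(I-H_kG_k)^{-1}F_k,$$ $$G_{k+1}=G_k+E_k(I-G_kH_k)^{-1}G_kF_k,\quad H_{k+1}=H_k+F_k(I-H_kG_k)^{-1}H_kE_k.$$ ''Well-defined'' means all inverses involved exist. Quadratic convergence of the doubling algorithm means $\limsup_{k\to\infty}\|H_k-\Phi\|^{1/2^k}<1$ and $\limsup_{k\to\infty}\|G_k-\Psi\|^{1/2^k}<1$. *)

(* Defs.v *)
From HB Require Import structures.
From mathcomp Require Import all_boot all_order all_algebra.
From mathcomp Require Import complex.
From mathcomp Require Import all_classical all_reals all_analysis.

Set Implicit Arguments.
Unset Strict Implicit.
Unset Printing Implicit Defensive.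

Import Order.TTheory GRing.Theory Num.Theory.

Local Open Scope ring_scope.

(* The real number omega * Re z + (1 - omega) * Im z. *)
Definition omega_re (R : realType) (omega : R) (z : R[i]) : R :=
  omega * complex.Re z + (1 - omega) * complex.Im z.

(* The real number omega * Im z - (1 - omega) * Re z. *)
Definition omega_im (R : realType) (omega : R) (z : R[i]) : R :=
  omega * complex.Im z - (1 - omega) * complex.Re z.

(* The modulus as an element of R; the norm `|z| of R[i] has values in R[i]. *)
Definition cmod (R : realType) (z : R[i]) : R := complex.Re `|z|.

Definition omega_comparison (R : realType) (k : nat) (omega : R)
    (M : 'M[R[i]]_k) : 'M[R]_k :=
  \matrix_(i, j) if i == j then omega_re omega (M i i) else - cmod (M i j).

Definition positive_vec (R : realType) (k : nat) (u : 'cV[R]_k) : Prop :=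
  forall i, 0 < u i 0.

Definition nonsingular_Mmatrix (R : realType) (k : nat) (M : 'M[R]_k) : Prop :=
  (forall i j, i != j -> M i j <= 0) /\
  (exists2 u : 'cV[R]_k, positive_vec u & positive_vec (M *m u)).

Section Riccati.
Context (R : realType) (m n : nat).
Implicit Types (A : 'M[R[i]]_m) (B : 'M[R[i]]_(m, n)) (C : 'M[R[i]]_(n, m))
  (D : 'M[R[i]]_n).

Definition riccati_mx A B C D : 'M[R[i]]_(n + m) := block_mx D (- C) (- B) A.

Definition class_H (omega : R) A B C D : Prop :=
  nonsingular_Mmatrix (omega_comparison omega (riccati_mx A B C D)).

Definition riccati_solution A B C D (X : 'M[R[i]]_(m, n)) : Prop :=
  X *m C *m X - X *m D - A *m X + B = 0.

(* The dual equation Y B Y - Y A - D Y + C = 0 and its matrix A - B Y are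
   obtained by exchanging A with D and B with C.  Uniqueness of the extremal
   solution is a theorem for equations in class H, so it is not part of the
   definition. *)
Definition extremal_solution (omega : R) A B C D (X : 'M[R[i]]_(m, n)) : Prop :=
  riccati_solution A B C D X /\
  (forall lambda : R[i], eigenvalue (D - C *m X) lambda ->
     0 < omega_re omega lambda).

Record doubling_iterate := DoublingIterate {
  dE : 'M[R[i]]_n;
  dF : 'M[R[i]]_m;
  dG : 'M[R[i]]_(n, m);
  dH : 'M[R[i]]_(m, n) }.

Definition shiftA (beta : R[i]) A : 'M[R[i]]_m := A + beta%:M.
Definition shiftD (alpha : R[i]) D : 'M[R[i]]_n := D + alpha%:M.

Definition schurW (alpha beta : R[i]) A B C D : 'M[R[i]]_m :=
  shiftA beta A - B *m invmx (shiftD alpha D) *m C.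
Definition schurV (alpha beta : R[i]) A B C D : 'M[R[i]]_n :=
  shiftD alpha D - C *m invmx (shiftA beta A) *m B.

(* invmx is total (the identity function on singular matrices); the existence
   of the inverses is expressed by sda_well_defined below. *)
Definition doubling_init (alpha beta : R[i]) A B C D : doubling_iterate :=
  let Dinv := invmx (shiftD alpha D) in
  let Winv := invmx (schurW alpha beta A B C D) in
  let Vinv := invmx (schurV alpha beta A B C D) in
  DoublingIterate
    (1%:M - (alpha + beta) *: Vinv)
    (1%:M - (alpha + beta) *: Winv)
    ((alpha + beta) *: (Dinv *m C *m Winv))
    ((alpha + beta) *: (Winv *m B *m Dinv)).

Definition doubling_step (s : doubling_iterate) : doubling_iterate :=
  let: DoublingIterate E F G H := s in
  let GHinv := invmx (1%:M - G *m H) in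
  let HGinv := invmx (1%:M - H *m G) in
  DoublingIterate
    (E *m GHinv *m E)
    (F *m HGinv *m F)
    (G + E *m GHinv *m G *m F)
    (H + F *m HGinv *m H *m E).

Definition sda (alpha : R[i]) A B C D (k : nat) : doubling_iterate :=
  iter k doubling_step (doubling_init alpha alpha A B C D).

Definition sda_well_defined (alpha : R[i]) A B C D : Prop :=
  [/\ shiftA alpha A \in unitmx,
      shiftD alpha D \in unitmx,
      schurW alpha alpha A B C D \in unitmx,
      schurV alpha alpha A B C D \in unitmx &
      forall k, let s := sda alpha A B C D k in
        1%:M - dG s *m dH s \in unitmx /\ 1%:M - dH s *m dG s \in unitmx].

End Riccati.

Section Convergence.
Context (R : realType) (p q : nat).

(* Real-valued norms on the complex vector space of p x q matrices. *)
Definition matrix_norm (N : 'M[R[i]]_(p, q) -> R) : Prop :=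
  [/\ forall X, N X = 0 -> X = 0,
      forall (a : R[i]) X, N (a *: X) = cmod a * N X &
      forall X Y, N (X + Y) <= N X + N Y].

(* The property does not depend on the norm, since all norms on a
   finite-dimensional space are equivalent; it is required for each of them. *)
Definition quadratic_cvg (X : nat -> 'M[R[i]]_(p, q)) (L : 'M[R[i]]_(p, q)) :
    Prop :=
  forall N : 'M[R[i]]_(p, q) -> R, matrix_norm N ->
    (limn_esup (fun k => (N (X k - L) `^ ((2 ^+ k)^-1))%:E) < 1%:E)%E.

End Convergence.

Definition offdiag_sum (R : realType) (k : nat) (Q : 'M[R[i]]_k) (i : 'I_k) : R :=
  \sum_(j < k | j != i) cmod (Q i j).

Definition tau (R : realType) (k : nat) (omega : R) (Q : 'M[R[i]]_k)
    (i : 'I_k) : R :=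
  let varpi := omega ^+ 2 + (1 - omega) ^+ 2 in
  let q := offdiag_sum Q i in
  let x := omega_re omega (Q i i) in
  let y := omega_im omega (Q i i) in
  varpi^-1 * Num.sqrt (q * (x + y ^+ 2 / (x - q))).

Definition z_perp (R : realType) (omega : R) : R[i] := Complex omega (1 - omega).

(* Main.v *)
Require Import Defs.
From HB Require Import structures.
From mathcomp Require Import all_boot all_order all_algebra.
From mathcomp Require Import complex.
From mathcomp Require Import all_classical all_reals all_analysis.
From mathcomp Require Import ring lra.

Set Implicit Arguments.
Unset Strict Implicit.
Unset Printing Implicit Defensive.

Import Order.TTheory GRing.Theory Num.Theory.
Import numFieldNormedType.Exports.

Local Open Scope ring_scope.

(** Rotating by the conjugate of [z_perp] turns [alpha] into a positive real
    shift and [omega_re] into a real part, so the algorithm is the usual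
    structure-preserving doubling algorithm for a matrix that is strictly
    diagonally dominant with diagonal in the right half plane.

    Collect the four matrices of an iterate into [S = [[E, G], [H, F]]].  The
    initialization says that [S] is the Cayley transform
    [(Q' + alpha)^-1 (Q' - alpha)] of [Q' = [[D, C], [B, A]]], whose entries have
    the moduli of those of [Q] ([doubling_init_cayley]).  The bound [tau < t]
    gives [|Q_ii - alpha| + 2 q_i < |Q_ii + alpha|] in every row
    ([tau_dominance]), and diagonal dominance then yields [|S| <= c < 1] in the
    row-sum norm ([cayley_iterate_contractive]).

    A doubling step is the Redheffer star product of [S] with itself.  It keeps
    the bound [|S| <= c] ([contractive_step]); hence [|G H| <= c ^ 2] and the
    inverses exist at every step.  It also satisfies [|E'| <= c |E|] and
    [|E'| <= |E| ^ 2 / (1 - c ^ 2)] ([rnormE_step]), and likewise for [F], so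
    that [E] and [F] tend to 0 quadratically ([quadratic_decay]).

    A solution [X] of the Riccati equation spans with [T], the Cayley transform of
    [D - C X], an invariant graph: [E + G X T = T] and [H + F X T = X].  A step
    replaces [T] by [T ^ 2] ([invariant_graph_step]), so that
    [X - H_k = F_k X T ^ (2 ^ k)].  For the extremal solution the eigenvalues of
    [T] lie in the open unit disc, its powers are bounded ([power_bounded]), and
    [H_k] inherits the quadratic rate of [F_k].  Exchanging the roles of [(A, B)]
    and [(D, C)] exchanges [E] with [F] and [G] with [H], which gives the
    convergence of [G_k] to the dual extremal solution. *)

(** * Moduli and the row-sum norm *)

Section RowSumNorm.
Context (R : realType).
Local Notation C := R[i].

Lemma cmodE (z : C) : cmod z = Num.sqrt (complex.Re z ^+ 2 + complex.Im z ^+ 2).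
Proof. by rewrite /cmod normc_def. Qed.

Lemma cmod_ge0 (z : C) : 0 <= cmod z.
Proof. by rewrite cmodE sqrtr_ge0. Qed.

Lemma sqr_cmod (z : C) : cmod z ^+ 2 = complex.Re z ^+ 2 + complex.Im z ^+ 2.
Proof. by rewrite cmodE sqr_sqrtr // addr_ge0 ?sqr_ge0. Qed.

Lemma norm_cmod (z : C) : `|z| = (cmod z)%:C%C.
Proof. by rewrite cmodE normc_def. Qed.

Lemma cmodM (y z : C) : cmod (y * z) = cmod y * cmod z.
Proof. by apply: (@complexI R); rewrite rmorphM /= -!norm_cmod normrM. Qed.

Lemma cmodN (z : C) : cmod (- z) = cmod z.
Proof. by rewrite /cmod normrN. Qed.

Lemma cmodD (y z : C) : cmod (y + z) <= cmod y + cmod z.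
Proof. by rewrite -lecR rmorphD /= -!norm_cmod ler_normD. Qed.

Lemma cmod0 : cmod (0 : C) = 0.
Proof. by rewrite /cmod normr0. Qed.

Lemma cmod1 : cmod (1 : C) = 1.
Proof. by rewrite /cmod normr1. Qed.

Lemma cmod_eq0 (z : C) : cmod z = 0 -> z = 0.
Proof. by move=> z0; apply: normr0_eq0; rewrite norm_cmod z0. Qed.

Lemma cmod_sum (I : Type) (r : seq I) (P : pred I) (f : I -> C) :
  cmod (\sum_(i <- r | P i) f i) <= \sum_(i <- r | P i) cmod (f i).
Proof.
elim/big_rec2: _ => [|i y z _ le_yz]; first by rewrite cmod0.
by apply: le_trans (cmodD _ _) _; rewrite lerD2l.
Qed.

Definition row_sum p q (M : 'M[C]_(p, q)) (i : 'I_p) : R :=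
  \sum_j cmod (M i j).

Definition rnorm p q (M : 'M[C]_(p, q)) : R :=
  \big[Order.max/0]_i row_sum M i.

Lemma row_sum_ge0 p q (M : 'M[C]_(p, q)) i : 0 <= row_sum M i.
Proof. by apply: sumr_ge0 => j _; exact: cmod_ge0. Qed.

Lemma rnorm_ge0 p q (M : 'M[C]_(p, q)) : 0 <= rnorm M.
Proof. exact: bigmax_ge_id. Qed.

Lemma row_sum_le_rnorm p q (M : 'M[C]_(p, q)) i : row_sum M i <= rnorm M.
Proof. exact: le_bigmax. Qed.

Lemma rnorm_leP p q (M : 'M[C]_(p, q)) c :
  0 <= c -> reflect (forall i, row_sum M i <= c) (rnorm M <= c).
Proof.
move=> c0; apply: (iffP idP) => [Mc i|Mc].
  exact: le_trans (row_sum_le_rnorm M i) Mc.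
by apply: bigmax_le.
Qed.

Lemma cmod_le_rnorm p q (M : 'M[C]_(p, q)) i j : cmod (M i j) <= rnorm M.
Proof.
apply: le_trans (row_sum_le_rnorm M i).
by rewrite /row_sum (bigD1 j) //= lerDl sumr_ge0 // => k _; exact: cmod_ge0.
Qed.

Lemma rnorm_eq0 p q (M : 'M[C]_(p, q)) : rnorm M <= 0 -> M = 0.
Proof.
move=> M0; apply/matrixP => i j; rewrite mxE; apply: cmod_eq0; apply/le_anti.
by rewrite cmod_ge0 andbT; exact: le_trans (cmod_le_rnorm M i j) M0.
Qed.

Lemma rnormN p q (M : 'M[C]_(p, q)) : rnorm (- M) = rnorm M.
Proof.
by apply: eq_bigr => i _; apply: eq_bigr => j _; rewrite mxE cmodN.
Qed.

Lemma rnormZ p q (a : C) (M : 'M[C]_(p, q)) :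
  rnorm (a *: M) <= cmod a * rnorm M.
Proof.
apply/rnorm_leP => [|i]; first by rewrite mulr_ge0 ?cmod_ge0 ?rnorm_ge0.
rewrite /row_sum; under eq_bigr do rewrite mxE cmodM.
by rewrite -mulr_sumr ler_wpM2l ?cmod_ge0 ?row_sum_le_rnorm.
Qed.

Lemma row_sumD p q (M N : 'M[C]_(p, q)) i :
  row_sum (M + N) i <= row_sum M i + row_sum N i.
Proof.
by rewrite -big_split ler_sum // => j _; rewrite mxE cmodD.
Qed.

Lemma rnormD p q (M N : 'M[C]_(p, q)) : rnorm (M + N) <= rnorm M + rnorm N.
Proof.
apply/rnorm_leP => [|i]; first by rewrite addr_ge0 ?rnorm_ge0.
by apply: le_trans (row_sumD _ _ _) _; rewrite lerD ?row_sum_le_rnorm.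
Qed.

Lemma row_sumM p q r (M : 'M[C]_(p, q)) (N : 'M[C]_(q, r)) i :
  row_sum (M *m N) i <= \sum_j cmod (M i j) * row_sum N j.
Proof.
have -> : \sum_j cmod (M i j) * row_sum N j =
    \sum_k \sum_j cmod (M i j) * cmod (N j k).
  by rewrite exchange_big; apply: eq_bigr => j _; rewrite mulr_sumr.
apply: ler_sum => k _; rewrite mxE; apply: le_trans (cmod_sum _ _ _) _.
by rewrite ler_sum // => j _; rewrite cmodM.
Qed.

Lemma rnormM p q r (M : 'M[C]_(p, q)) (N : 'M[C]_(q, r)) :
  rnorm (M *m N) <= rnorm M * rnorm N.
Proof.
apply/rnorm_leP => [|i]; first by rewrite mulr_ge0 ?rnorm_ge0.
apply: le_trans (row_sumM _ _ _) _.
apply: le_trans (_ : row_sum M i * rnorm N <= _).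
  rewrite mulr_suml ler_sum // => j _.
  by rewrite ler_wpM2l ?cmod_ge0 ?row_sum_le_rnorm.
by rewrite ler_wpM2r ?rnorm_ge0 ?row_sum_le_rnorm.
Qed.

Lemma row_sum_row_mx p q1 q2 (M : 'M[C]_(p, q1)) (N : 'M[C]_(p, q2)) i :
  row_sum (row_mx M N) i = row_sum M i + row_sum N i.
Proof.
rewrite /row_sum big_split_ord /=; congr (_ + _);
by apply: eq_bigr => j _; rewrite ?row_mxEl ?row_mxEr.
Qed.

Lemma rnorm_row_mxC p q1 q2 (M : 'M[C]_(p, q1)) (N : 'M[C]_(p, q2)) :
  rnorm (row_mx M N) = rnorm (row_mx N M).
Proof. by apply: eq_bigr => i _; rewrite !row_sum_row_mx addrC. Qed.

Lemma rnorm_row_mxl p q1 q2 (M : 'M[C]_(p, q1)) (N : 'M[C]_(p, q2)) :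
  rnorm M <= rnorm (row_mx M N).
Proof.
apply/rnorm_leP => [|i]; first exact: rnorm_ge0.
apply: le_trans (row_sum_le_rnorm _ i).
by rewrite row_sum_row_mx lerDl row_sum_ge0.
Qed.

Lemma rnorm_row_mxr p q1 q2 (M : 'M[C]_(p, q1)) (N : 'M[C]_(p, q2)) :
  rnorm N <= rnorm (row_mx M N).
Proof. by rewrite rnorm_row_mxC rnorm_row_mxl. Qed.

Lemma rnorm_col_mx p1 p2 q (M : 'M[C]_(p1, q)) (N : 'M[C]_(p2, q)) :
  rnorm (col_mx M N) = Order.max (rnorm M) (rnorm N).
Proof.
have colu i : row_sum (col_mx M N) (lshift p2 i) = row_sum M i.
  by apply: eq_bigr => j _; rewrite col_mxEu.
have cold i : row_sum (col_mx M N) (rshift p1 i) = row_sum N i.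
  by apply: eq_bigr => j _; rewrite col_mxEd.
apply/le_anti/andP; split.
  apply/rnorm_leP => [|i]; first by rewrite le_max rnorm_ge0.
  by case: (split_ordP i) => j ->; rewrite ?colu ?cold le_max
    row_sum_le_rnorm ?orbT.
rewrite ge_max; apply/andP; split; apply/rnorm_leP => [|i];
  rewrite ?rnorm_ge0 // -?colu -?cold; exact: row_sum_le_rnorm.
Qed.

Lemma rnorm_addM p q1 q2 r (M : 'M[C]_(p, q1)) (N : 'M[C]_(p, q2))
    (X : 'M[C]_(q1, r)) (Y : 'M[C]_(q2, r)) c :
  rnorm (row_mx M N) <= c ->
  rnorm (M *m X + N *m Y) <= c * Order.max (rnorm X) (rnorm Y).
Proof.
move=> MNc; rewrite -mul_row_col; apply: le_trans (rnormM _ _) _.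
by rewrite rnorm_col_mx ler_wpM2r // le_max rnorm_ge0.
Qed.

Lemma rnorm_scalar_mx1 p : rnorm (1%:M : 'M[C]_p) <= 1.
Proof.
apply/rnorm_leP => // i; rewrite /row_sum (bigD1 i) //= mxE eqxx cmod1.
rewrite big1 ?addr0 // => j ji.
by rewrite mxE eq_sym (negbTE ji) cmod0.
Qed.

Lemma rnorm0 p q : rnorm (0 : 'M[C]_(p, q)) = 0.
Proof.
apply/le_anti; rewrite rnorm_ge0 andbT; apply/rnorm_leP => // i.
by rewrite /row_sum big1 // => j _; rewrite mxE cmod0.
Qed.

Lemma unitmx_inj p (M : 'M[C]_p) :
  (forall X : 'M[C]_p, M *m X = 0 -> X = 0) -> M \in unitmx.
Proof.
move=> Minj; have /Minj coker0 := mulmx_coker M.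
rewrite -row_full_unit /row_full eqn_leq rank_leq_col /=.
by rewrite -subn_eq0 -mxrank_coker coker0 mxrank0.
Qed.

Lemma unitmx_1B p (M : 'M[C]_p) : rnorm M < 1 -> 1%:M - M \in unitmx.
Proof.
move=> M1; apply: unitmx_inj => X.
rewrite mulmxBl mul1mx => /eqP; rewrite subr_eq0 => /eqP XE.
apply: rnorm_eq0; rewrite leNgt; apply/negP => X0.
have := rnormM M X; rewrite -XE leNgt => /negP; apply.
by rewrite gtr_pMl.
Qed.

(** The maximum principle behind every use of diagonal dominance: comparing
    both sides of [M X = N] in the row where [X] has its largest row sum. *)
Lemma diag_dominant_rnorm p q (M : 'M[C]_p) (X N : 'M[C]_(p, q)) c :
  0 <= c ->
  (forall i, offdiag_sum M i < cmod (M i i)) ->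
  M *m X = N ->
  (forall i, row_sum N i <= c * (cmod (M i i) - offdiag_sum M i)) ->
  rnorm X <= c.
Proof.
move=> c0 Mdom MXN Nc; apply/rnorm_leP => // k; rewrite leNgt; apply/negP => ck.
pose i := [arg max_(i > k) row_sum X i]%O.
have iX j : row_sum X j <= row_sum X i.
  by rewrite /i; case: arg_maxP => // i' _; exact.
have ci : c < row_sum X i by exact: lt_le_trans ck (iX k).
pose Mo := \matrix_(i, j) if j == i then 0 else M i j.
have Mii : cmod (M i i) * row_sum X i = row_sum (N - Mo *m X) i.
  rewrite mulr_sumr; apply: eq_bigr => l _; rewrite -cmodM; congr cmod.
  rewrite -MXN !mxE (bigD1 i) //= (bigD1 i (F := fun j => Mo i j * X j l)) //=.
  rewrite mxE eqxx mul0r add0r [X in _ = _ + _ - X](_ : _ =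
    \sum_(j | j != i) M i j * X j l) ?addrK //.
  by apply: eq_bigr => j /negbTE ji; rewrite mxE ji.
have MoX : row_sum (- (Mo *m X)) i <= offdiag_sum M i * row_sum X i.
  have -> : row_sum (- (Mo *m X)) i = row_sum (Mo *m X) i.
    by apply: eq_bigr => l _; rewrite mxE cmodN.
  apply: le_trans (row_sumM _ _ _) _.
  rewrite (bigD1 i) //= mxE eqxx cmod0 mul0r add0r mulr_suml.
  apply: ler_sum => j /negbTE ji.
  by rewrite mxE ji ler_wpM2l ?cmod_ge0.
have := row_sumD N (- (Mo *m X)) i; have := Nc i; have := Mdom i.
rewrite -Mii; nra.
Qed.

Lemma diag_dominant_unitmx p (M : 'M[C]_p) :
  (forall i, offdiag_sum M i < cmod (M i i)) -> M \in unitmx.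
Proof.
move=> Mdom; apply: unitmx_inj => X MX0; apply: rnorm_eq0.
apply: (diag_dominant_rnorm _ Mdom MX0) => // i; rewrite mul0r.
by rewrite /row_sum big1 // => j _; rewrite mxE cmod0.
Qed.

End RowSumNorm.

(** * Power boundedness *)

(** Cayley--Hamilton reduces the bound on the powers to scalar recursions: if
    the powers of [T] times [M (T - mu)] are bounded by [W], then the norms
    [a k] of [M T ^+ k] satisfy [a k.+1 <= |mu| a k + W], which keeps them
    bounded when [|mu| < 1].  The eigenvalues are peeled off one at a time. *)
Lemma power_bounded (R : realType) n (T : 'M[R[i]]_n) :
  (forall mu, eigenvalue T mu -> cmod mu < 1) ->
  exists W, forall k, rnorm (T ^+ k) <= W.
Proof.
case: n T => [|n] T Tlt1.
  by exists 0 => k; apply/rnorm_leP => // -[].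
have peel (s : seq R[i]) : (forall mu, mu \in s -> cmod mu < 1) ->
    forall M : 'M[R[i]]_n.+1,
    M *m horner_mx T (\prod_(mu <- s) ('X - mu%:P)) = 0 ->
    exists W, forall k, rnorm (M *m T ^+ k) <= W.
  elim: s => [|mu s IH] slt1 M.
    rewrite big_nil rmorph1 mulmx1 => ->; exists 0 => k.
    by rewrite mul0mx rnorm0.
  rewrite big_cons rmorphM /= mulmxA => /IH[|W WT].
    by move=> nu nus; apply: slt1; rewrite inE nus orbT.
  have mu1 : cmod mu < 1 by apply: slt1; rewrite mem_head.
  exists (Order.max (rnorm M) (W / (1 - cmod mu))) => k.
  elim: k => [|k IHk]; first by rewrite expr0 mulmx1 le_max lexx.
  have -> : M *m T ^+ k.+1 = mu *: (M *m T ^+ k) +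
      M *m horner_mx T ('X - mu%:P) *m T ^+ k.
    rewrite rmorphB /= horner_mx_X horner_mx_C mulmxBr mulmxBl exprS.
    by rewrite mul_mx_scalar -scalemxAl mulmxA addrC subrK.
  apply: le_trans (rnormD _ _) _; apply: le_trans (lerD (rnormZ _ _) (WT k)) _.
  set K := Order.max _ _ in IHk *.
  have WK : W <= K * (1 - cmod mu).
    by rewrite -ler_pdivrMr ?subr_gt0 // le_max lexx orbT.
  have := ler_wpM2l (cmod_ge0 mu) IHk; lra.
have [s sE] := closed_field_poly_normal (char_poly T).
rewrite (monicP (char_poly_monic T)) scale1r in sE.
have [|| W WT] := peel s _ 1%:M; last by exists W => k;
  rewrite -(mul1mx (T ^+ k)).
- by move=> mu mus; apply: Tlt1; rewrite eigenvalue_root_char sE root_prod_XsubC.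
- by rewrite mul1mx -sE; exact: Cayley_Hamilton.
Qed.

(** * Quadratic rates *)

Section Rates.
Context (R : realType).

Lemma small_expr (K c e : R) : 0 <= c -> c < 1 -> 0 < e ->
  exists k0, forall k, (k0 <= k)%N -> K * c ^+ k < e.
Proof.
move=> c0 c1 e0.
have : ((fun k => K * c ^+ k) @ \oo --> K * 0)%classic.
  by apply: cvgMr; apply: cvg_expr; rewrite ger0_norm.
rewrite mulr0 => /cvgrPdist_lt /(_ e e0) [k0 _ k0P]; exists k0 => k k0k.
have /= := k0P k k0k; rewrite sub0r normrN; exact: le_lt_trans (ler_norm _).
Qed.

(** The linear estimate only serves to bring [K * a k0] below 1; from there on
    the quadratic one squares the bound at each step, and the base [rho] is the
    [2 ^ k0]-th root of [K * a k0]. *)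
Lemma quadratic_decay (a : nat -> R) (c K : R) :
  (forall k, 0 <= a k) -> 0 <= c -> c < 1 -> 0 < K ->
  (forall k, a k.+1 <= c * a k) -> (forall k, a k.+1 <= K * a k ^+ 2) ->
  exists rho, [/\ 0 <= rho, rho < 1 &
    exists k0, forall k, (k0 <= k)%N -> K * a k <= rho ^+ (2 ^ k)].
Proof.
move=> a0 c0 c1 K0 alin aquad.
have ageo k : a k <= a 0%N * c ^+ k.
  elim: k => [|k IH]; first by rewrite expr0 mulr1.
  by apply: le_trans (alin k) _; rewrite exprS mulrCA ler_wpM2l.
have [k0 /(_ k0 (leqnn _)) k0P] := small_expr (K * a 0%N) c0 c1 ltr01.
pose b := K * a k0.
have b0 : 0 <= b by rewrite mulr_ge0 // ltW.
have b1 : b < 1.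
  by apply: le_lt_trans k0P; rewrite -mulrA ler_wpM2l // ltW.
have p0 : (0 : R) < 2 ^- k0 by rewrite invr_gt0 exprn_gt0.
exists (b `^ (2 ^- k0)); split; first exact: powR_ge0.
  have := gt0_ltr_powR p0 _ _ b1; rewrite powR1; apply; rewrite nnegrE //.
exists k0 => k /subnKC <-; elim: (k - k0)%N => [|j IH].
  rewrite addn0 -powR_mulrn ?powR_ge0 // -powRrM natrX mulVf ?powRr1 //.
rewrite addnS expnSr exprM; apply: le_trans (_ : (K * a (k0 + j)%N) ^+ 2 <= _).
  by rewrite exprMn expr2 -mulrA ler_wpM2l ?aquad // ltW.
by rewrite lerXn2r // nnegrE ?exprn_ge0 ?powR_ge0 // mulr_ge0 // ltW.
Qed.

Lemma matrix_norm_ge0 p q (N : 'M[R[i]]_(p, q) -> R) X :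
  matrix_norm N -> 0 <= N X.
Proof.
case=> _ NZ ND; have N0 : N 0 = 0 by rewrite -(scale0r X) NZ cmod0 mul0r.
have := ND X (- X); rewrite subrr N0 -scaleN1r NZ cmodN cmod1 mul1r; lra.
Qed.

Lemma matrix_norm_le_rnorm p q (N : 'M[R[i]]_(p, q) -> R) :
  matrix_norm N -> exists2 K, 0 <= K & forall X, N X <= K * rnorm X.
Proof.
move=> Nn; have [_ NZ ND] := Nn.
have N0 : N 0 = 0 by rewrite -(scale0r 0) NZ cmod0 mul0r.
have Nsum I (r : seq I) (f : I -> 'M[R[i]]_(p, q)) :
    N (\sum_(i <- r) f i) <= \sum_(i <- r) N (f i).
  elim/big_rec2: _ => [|i y z _ le_yz]; first by rewrite N0.
  by apply: le_trans (ND _ _) _; rewrite lerD2l.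
exists (\sum_i \sum_j N (delta_mx i j)) => [|X].
  by apply: sumr_ge0 => i _; apply: sumr_ge0 => j _; exact: matrix_norm_ge0.
rewrite {1}[X]matrix_sum_delta; apply: le_trans (Nsum _ _ _) _.
rewrite mulr_suml; apply: ler_sum => i _; apply: le_trans (Nsum _ _ _) _.
rewrite mulr_suml; apply: ler_sum => j _; rewrite NZ mulrC.
by rewrite ler_wpM2l ?cmod_le_rnorm ?matrix_norm_ge0.
Qed.

(** Multiplicative constants, hence also the choice of the norm, are absorbed
    by enlarging the base of the doubly exponential rate. *)
Lemma quadratic_cvg_rate p q (X : nat -> 'M[R[i]]_(p, q)) L (K rho : R) k0 :
  0 <= rho -> rho < 1 ->
  (forall k, (k0 <= k)%N -> rnorm (X k - L) <= K * rho ^+ (2 ^ k)) ->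
  quadratic_cvg X L.
Proof.
move=> rho0 rho1 Xrho N Nn.
have [KN KN0 NK] := matrix_norm_le_rnorm Nn.
pose s := (1 + rho) / 2.
have [s0 s1 rhos] : [/\ 0 < s, s < 1 & rho < s] by rewrite /s; split; lra.
have rs0 : 0 <= rho / s by rewrite divr_ge0 // ltW.
have rs1 : rho / s < 1 by rewrite ltr_pdivrMr // mul1r.
have [k1 k1P] := small_expr (KN * K) rs0 rs1 ltr01.
have Xs k : (maxn k0 k1 <= k)%N -> N (X k - L) `^ (2 ^+ k)^-1 <= s.
  rewrite geq_max => /andP[k0k k1k].
  have p0 : (0 : R) < 2 ^- k by rewrite invr_gt0 exprn_gt0.
  have -> : s = (s ^+ (2 ^ k)) `^ (2 ^- k).
    rewrite -powR_mulrn ?(ltW s0) // -powRrM natrX mulfV ?powRr1 ?(ltW s0) //.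
  apply: ge0_ler_powR; rewrite ?nnegrE ?(ltW p0) ?exprn_ge0 ?(ltW s0) //.
    exact: matrix_norm_ge0.
  apply: le_trans (NK _) _; apply: le_trans (ler_wpM2l KN0 (Xrho k k0k)) _.
  rewrite mulrA -[leRHS]mul1r -ler_pdivrMr ?exprn_gt0 // -(mulrA (KN * K)) -expr_div_n.
  apply/ltW/k1P/(leq_trans k1k)/ltnW; exact: ltn_expl.
apply: (@le_lt_trans _ _ s%:E); last by rewrite lte_fin.
apply: ereal_inf_le; exists (ereal_sup [set (N (X k - L) `^ (2 ^+ k)^-1)%:E |
    k in [set k | (maxn k0 k1 <= k)%N]])%classic.
  by exists [set k | (maxn k0 k1 <= k)%N]%classic => //; exists (maxn k0 k1).
by apply: ub_ereal_sup => _ [k kk <-]; rewrite lee_fin Xs.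
Qed.

End Rates.

(** * The doubling step *)

Section DoublingStep.
Context (R : realType).
Implicit Types (m n : nat) (c : R).

(** Exchange of the two ports; it reduces statements about [F] and [H] to those
    about [E] and [G]. *)
Definition swap m n (s : doubling_iterate R m n) : doubling_iterate R n m :=
  DoublingIterate (dF s) (dE s) (dH s) (dG s).

Lemma doubling_step_swap m n (s : doubling_iterate R m n) :
  doubling_step (swap s) = swap (doubling_step s).
Proof. by case: s. Qed.

(** [[E, G], [H, F]] acts as a scattering matrix, taking the two waves that enter
    a device to the two that leave it; for the row-sum norm, a bound on it is a
    bound on each of its block rows. *)
Definition contractive m n c (s : doubling_iterate R m n) : Prop :=
  rnorm (row_mx (dE s) (dG s)) <= c /\ rnorm (row_mx (dH s) (dF s)) <= c.

Lemma contractive_swap m n c (s : doubling_iterate R m n) :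
  contractive c s -> contractive c (swap s).
Proof. by case=> sEG sHF; split; rewrite rnorm_row_mxC. Qed.

Lemma contractive_rnormGH m n c (s : doubling_iterate R m n) :
  0 <= c -> contractive c s -> rnorm (dG s *m dH s) <= c ^+ 2.
Proof.
move=> c0 [sEG sHF]; apply: le_trans (rnormM _ _) _.
rewrite expr2 ler_pM ?rnorm_ge0 //.
  exact: le_trans (rnorm_row_mxr _ _) sEG.
exact: le_trans (rnorm_row_mxl _ _) sHF.
Qed.

Lemma contractive_unit m n c (s : doubling_iterate R m n) :
  0 <= c -> c < 1 -> contractive c s -> 1%:M - dG s *m dH s \in unitmx.
Proof.
move=> c0 c1 sc; apply: unitmx_1B.
by apply: le_lt_trans (contractive_rnormGH c0 sc) _; rewrite expr_lt1.
Qed.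

(** Two scattering devices in series: [X] and [Y] are the waves travelling
    between them, [P] and [P'] the incoming ones.  If [X] exceeded [c], then each
    inner wave would be at most [c] times the other, which is absurd. *)
Lemma inner_wave m n p c (E : 'M[R[i]]_n) (G : 'M[R[i]]_(n, m))
    (H : 'M[R[i]]_(m, n)) (F : 'M[R[i]]_m) (X P : 'M[R[i]]_(n, p))
    (Y P' : 'M[R[i]]_(m, p)) :
  0 <= c -> c < 1 ->
  rnorm (row_mx E G) <= c -> rnorm (row_mx H F) <= c ->
  rnorm P <= 1 -> rnorm P' <= 1 ->
  X = E *m P + G *m Y -> Y = H *m X + F *m P' ->
  rnorm X <= c.
Proof.
move=> c0 c1 EGc HFc P1 P'1 XE YE.
have Xc : rnorm X <= c * Order.max 1 (rnorm Y).
  rewrite {1}XE; apply: le_trans (rnorm_addM _ _ EGc) _.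
  rewrite ler_wpM2l // ge_max !le_max P1 lexx; lra.
have Yc : rnorm Y <= c * Order.max (rnorm X) 1.
  rewrite {1}YE; apply: le_trans (rnorm_addM _ _ HFc) _.
  rewrite ler_wpM2l // ge_max !le_max P'1 lexx orbT; lra.
have := rnorm_ge0 X; have := rnorm_ge0 Y; move: Xc Yc.
case: (leP 1 (rnorm Y)) => ?; last by rewrite mulr1.
case: (leP (rnorm X) 1) => ? *; nra.
Qed.

Lemma contractive_step_half m n c (s : doubling_iterate R m n) :
  0 <= c -> c < 1 -> contractive c s ->
  rnorm (row_mx (dE (doubling_step s)) (dG (doubling_step s))) <= c.
Proof.
move=> c0 c1 sc; have := contractive_unit c0 c1 sc.
case: s sc => E F G H [/= EGc HFc] Ku; set K := 1%:M - G *m H in Ku *.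
(* [P] and [P'] are the block rows of the identity: the unit incoming waves. *)
pose P : 'M[R[i]]_(n, n + m) := row_mx 1%:M 0.
pose P' : 'M[R[i]]_(m, n + m) := row_mx 0 1%:M.
pose X := invmx K *m row_mx E (G *m F).
pose Y := H *m X + F *m P'.
have P1 : rnorm P <= 1.
  apply: le_trans (rnorm_scalar_mx1 R (n + m)).
  by rewrite scalar_mx_block /block_mx rnorm_col_mx le_max lexx.
have P'1 : rnorm P' <= 1.
  apply: le_trans (rnorm_scalar_mx1 R (n + m)).
  by rewrite scalar_mx_block /block_mx rnorm_col_mx le_max lexx orbT.
have XE : X = E *m P + G *m Y.
  have KX : X - G *m H *m X = row_mx E (G *m F).
    by rewrite -{1}(mul1mx X) -mulmxBl -/K mulKVmx.
  rewrite /Y mulmxDr (mulmxA G H) (mulmxA G F) !mul_mx_row !mulmx0 !mulmx1.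
  by rewrite (addrC (G *m H *m X)) addrA add_row_mx addr0 add0r -KX subrK.
have Xc := inner_wave c0 c1 EGc HFc P1 P'1 XE (erefl Y).
have -> : row_mx (E *m invmx K *m E) (G + E *m invmx K *m G *m F) =
    E *m X + G *m P'.
  by rewrite /X !mul_mx_row add_row_mx mulmx0 mulmx1 addr0 !mulmxA addrC.
apply: le_trans (rnorm_addM _ _ EGc) _.
rewrite -[leRHS]mulr1 ler_wpM2l // ge_max P'1 andbT.
exact: le_trans Xc (ltW c1).
Qed.

(** The Redheffer star product of a contraction with itself is a contraction
    with the same constant. *)
Lemma contractive_step m n c (s : doubling_iterate R m n) :
  0 <= c -> c < 1 -> contractive c s -> contractive c (doubling_step s).
Proof.
move=> c0 c1 sc; split; first exact: contractive_step_half.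
have := contractive_step_half c0 c1 (contractive_swap sc).
by rewrite doubling_step_swap rnorm_row_mxC.
Qed.

(** The new [E] is [E X], where [X] is the inner wave created by the incoming
    wave [1] alone.  The first bound uses [|X| <= c]; the second one solves
    [X = E + G H X] for [|X|]. *)
Lemma rnormE_step m n c (s : doubling_iterate R m n) :
  0 <= c -> c < 1 -> contractive c s ->
  rnorm (dE (doubling_step s)) <= c * rnorm (dE s) /\
  rnorm (dE (doubling_step s)) <= (1 - c ^+ 2)^-1 * rnorm (dE s) ^+ 2.
Proof.
move=> c0 c1 sc; have Ku := contractive_unit c0 c1 sc.
have GHc := contractive_rnormGH c0 sc.
case: s sc Ku GHc => E F G H [/= EGc HFc]; set K := 1%:M - _ => Ku GHc.
pose X := invmx K *m E.
have XE : X = E + G *m (H *m X).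
  have <- : X - G *m H *m X = E by rewrite -{1}(mul1mx X) -mulmxBl mulKVmx.
  by rewrite mulmxA subrK.
have XE' : X = E *m 1%:M + G *m (H *m X) by rewrite mulmx1.
have YE : H *m X = H *m X + F *m 0 by rewrite mulmx0 addr0.
have Xc : rnorm X <= c.
  apply: inner_wave c0 c1 EGc HFc _ _ XE' YE; first exact: rnorm_scalar_mx1.
  by rewrite rnorm0.
have c2 : 0 < 1 - c ^+ 2 by rewrite subr_gt0 expr_lt1.
have XEn : rnorm X <= (1 - c ^+ 2)^-1 * rnorm E.
  rewrite ler_pdivlMl //.
  have : rnorm X <= rnorm E + c ^+ 2 * rnorm X.
    rewrite {1}XE mulmxA; apply: le_trans (rnormD _ _) _; rewrite lerD2l.
    by apply: le_trans (rnormM _ _) _; rewrite ler_wpM2r ?rnorm_ge0.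
  lra.
rewrite -mulmxA -/X; split; apply: le_trans (rnormM _ _) _.
  by rewrite mulrC ler_wpM2r ?rnorm_ge0.
by rewrite expr2 mulrCA ler_wpM2l ?rnorm_ge0.
Qed.

(** The device maps the incoming waves [1] and [X T] to the outgoing waves [T]
    and [X]: the graph of [X] is an invariant subspace of the matrix pencil of
    the iterate, on which it acts as [T]. *)
Definition invariant_graph m n (s : doubling_iterate R m n)
    (X : 'M[R[i]]_(m, n)) (T : 'M[R[i]]_n) : Prop :=
  dE s + dG s *m X *m T = T /\ dH s + dF s *m X *m T = X.

(** Two copies of the device in series: the waves between them are [T] and [X T],
    and the second copy repeats the first one multiplied by [T] on the right. *)
Lemma invariant_graph_step m n (s : doubling_iterate R m n) X T :
  1%:M - dG s *m dH s \in unitmx -> 1%:M - dH s *m dG s \in unitmx ->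
  invariant_graph s X T -> invariant_graph (doubling_step s) X (T *m T).
Proof.
case: s => E F G H /=; set K := 1%:M - _ => Ku.
set L := 1%:M - _ => Lu [/= ET HX].
have XT : X *m T = H *m T + F *m X *m T *m T by rewrite -{1}HX mulmxDl.
have KT : K *m T = E + G *m F *m X *m T *m T.
  rewrite mulmxBl mul1mx -[X in X - _]ET -(mulmxA G X T) XT mulmxDr !mulmxA.
  by rewrite (addrC (G *m H *m T)) addrA addrK.
have LXT : L *m (X *m T) = H *m E + F *m X *m T *m T.
  rewrite mulmxBl mul1mx [X in X - _]XT -{1}ET mulmxDr !mulmxA.
  by rewrite addrAC addrK.
clearbody K L.
have TE : T = invmx K *m E + invmx K *m G *m F *m X *m T *m T.
rewrite -[LHS](mulKmx Ku) KT mulmxDr !mulmxA; reflexivity.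
have XTE : X *m T = invmx L *m H *m E + invmx L *m F *m X *m T *m T.
  rewrite -[LHS](mulKmx Lu) LXT mulmxDr !mulmxA; reflexivity.
split=> /=.
  transitivity (E *m T + G *m X *m T *m T); last by rewrite -mulmxDl ET.
  have -> : E *m T = E *m invmx K *m E + E *m invmx K *m G *m F *m X *m T *m T.
    rewrite {1}TE mulmxDr !mulmxA; reflexivity.
  rewrite !mulmxDl !mulmxA -!addrA [X in _ + X = _]addrC; reflexivity.
rewrite -[RHS]HX -[X in _ = _ + X]mulmxA XTE.
rewrite mulmxDr !mulmxA addrA; reflexivity.
Qed.

End DoublingStep.

Section DoublingConvergence.
Context (R : realType) (m n : nat).
Implicit Type s : doubling_iterate R m n.

Lemma contractive_iter c s k :
  0 <= c -> c < 1 -> contractive c s ->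
  contractive c (iter k (@doubling_step R m n) s).
Proof. by move=> c0 c1 sc; elim: k => //= k; exact: contractive_step. Qed.

Lemma contractive_iter_unit c s k (sk := iter k (@doubling_step R m n) s) :
  0 <= c -> c < 1 -> contractive c s ->
  1%:M - dG sk *m dH sk \in unitmx /\ 1%:M - dH sk *m dG sk \in unitmx.
Proof.
move=> c0 c1 /(contractive_iter k c0 c1) sc.
split; first exact: contractive_unit sc.
exact: contractive_unit (contractive_swap sc).
Qed.

Lemma invariant_graph_iter c s X T k : 0 <= c -> c < 1 -> contractive c s ->
  invariant_graph s X T ->
  invariant_graph (iter k (@doubling_step R m n) s) X (T ^+ (2 ^ k)).
Proof.
move=> c0 c1 sc sX; elim: k => [|k IH]; first by rewrite expr1.
have [Ku Lu] := contractive_iter_unit k c0 c1 sc.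
by rewrite iterS expnSr exprM expr2; exact: invariant_graph_step.
Qed.

(** After [k] steps the graph relation reads [X - H k = F k X T ^+ (2 ^ k)]: the
    factor [F k] decays doubly exponentially and the powers of [T] stay bounded. *)
Lemma doubling_quadratic_cvg c s X T : 0 <= c -> c < 1 -> contractive c s ->
  invariant_graph s X T -> (forall mu, eigenvalue T mu -> cmod mu < 1) ->
  quadratic_cvg (fun k => dH (iter k (@doubling_step R m n) s)) X.
Proof.
move=> c0 c1 sc sX Tlt1; have [W TW] := power_bounded Tlt1.
pose a k := rnorm (dF (iter k (@doubling_step R m n) s)).
have Kc : 0 < (1 - c ^+ 2)^-1 by rewrite invr_gt0 subr_gt0 expr_lt1.
have a_step k : a k.+1 <= c * a k /\ a k.+1 <= (1 - c ^+ 2)^-1 * a k ^+ 2.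
  have := rnormE_step c0 c1 (contractive_swap (contractive_iter k c0 c1 sc)).
  by rewrite doubling_step_swap.
have [rho [rho0 rho1 [k0 k0P]]] := @quadratic_decay R a c _
  (fun k => rnorm_ge0 _) c0 c1 Kc (fun k => (a_step k).1) (fun k => (a_step k).2).
pose K := (1 - c ^+ 2) * (rnorm X * W).
apply: (quadratic_cvg_rate (K := K) (k0 := k0) rho0 rho1) => k k0k.
have [_ XE] := invariant_graph_iter k c0 c1 sc sX.
rewrite -[X in _ - X]XE opprD addrA subrr add0r rnormN.
apply: le_trans (rnormM _ _) _.
apply: le_trans (_ : a k * rnorm X * W <= _).
  by rewrite ler_pM ?rnorm_ge0 // rnormM.
rewrite -mulrA /K [leRHS]mulrAC ler_wpM2r //.
  by rewrite mulr_ge0 ?rnorm_ge0 // (le_trans _ (TW 0%N)) ?rnorm_ge0.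
by rewrite -ler_pdivrMl ?k0P // -invr_gt0.
Qed.

End DoublingConvergence.

(** * The initial iterate as a Cayley transform *)

Section Initialization.
Context (R : realType).

Section CayleySpectrum.
Context (n : nat) (a : R[i]) (S : 'M[R[i]]_n).
Context (a_neq0 : a != 0).
Context (S_spec :
  forall la, eigenvalue S la -> cmod (la - a) < cmod (la + a)).

Lemma cayley_unit : S + a%:M \in unitmx.
Proof.
case: (boolP (S + a%:M \in unitmx)) => // Sa; have /S_spec : eigenvalue S (- a).
  by rewrite /eigenvalue /eigenspace kermx_eq0 row_free_unit rmorphN opprK.
by rewrite addNr cmod0 ltNge cmod_ge0.
Qed.

(** An eigenvalue [mu] of the Cayley transform comes from the eigenvalue
    [la = (1 + mu) a / (1 - mu)] of [S], and [la - a = mu (la + a)]. *)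
Lemma cayley_eigenvalue mu :
  eigenvalue (invmx (S + a%:M) *m (S - a%:M)) mu -> cmod mu < 1.
Proof.
move=> /eigenvalueP [v vT v0]; have Su := cayley_unit.
pose u := v *m invmx (S + a%:M).
have vE : v = u *m (S + a%:M) by rewrite mulmxKV.
have u0 : u != 0 by apply: contra_neq v0 => u0; rewrite vE u0 mul0mx.
have uS : (1 - mu) *: (u *m S) = ((1 + mu) * a) *: u.
  move: vT; rewrite mulmxA -/u vE mulmxBr mulmxDr !mul_mx_scalar.
  move=> /eqP; rewrite subr_eq scalerDr => /eqP uSE.
  rewrite scalerBl scale1r {1}uSE mulrDl mul1r scalerDl scalerA.
  by rewrite [LHS]addrAC [X in X + _ = _]addrAC subrr add0r addrC.
have mu1 : 1 - mu != 0.
  apply: contraTneq u0 => mu1; move: uS; rewrite mu1 scale0r => /esym/eqP.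
  rewrite scaler_eq0 mulf_eq0 (negbTE a_neq0) orbF.
  suff /negbTE -> : 1 + mu != 0 by move=> /= ->.
  have -> : mu = 1 by apply/eqP; rewrite eq_sym -subr_eq0 mu1.
  by rewrite -mulr2n pnatr_eq0.
pose la := (1 + mu) * a / (1 - mu).
have la_eig : eigenvalue S la.
  apply/eigenvalueP; exists u => //; rewrite /la mulrC -scalerA -uS scalerA.
  by rewrite mulVf // scale1r.
have := S_spec la_eig; have -> : la - a = mu * (la + a) by rewrite /la; field.
rewrite cmodM => lamu; have := cmod_ge0 (la + a); nra.
Qed.

End CayleySpectrum.

(** With [M] and [N] the block matrices [[D + a, C], [B, A + a]] and
    [[D - a, C], [B, A - a]], these are the four blocks of [M S = N], where [S]
    is the scattering matrix of [s]. *)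
Definition cayley_iterate m n (a : R[i]) (A : 'M[R[i]]_m) (B : 'M[R[i]]_(m, n))
    (C : 'M[R[i]]_(n, m)) (D : 'M[R[i]]_n) (s : doubling_iterate R m n) : Prop :=
  [/\ shiftD a D *m dE s + C *m dH s = D - a%:M,
      shiftD a D *m dG s + C *m dF s = C,
      B *m dE s + shiftA a A *m dH s = B &
      B *m dG s + shiftA a A *m dF s = A - a%:M].

Lemma cayley_iterate_swap m n a A B C D (s : doubling_iterate R m n) :
  cayley_iterate a A B C D s -> cayley_iterate a D C B A (swap s).
Proof. by case=> DE DG AH AF; split; rewrite addrC. Qed.

Definition shifted_block m n (a : R[i]) (A : 'M[R[i]]_m) (B : 'M[R[i]]_(m, n))
    (C : 'M[R[i]]_(n, m)) (D : 'M[R[i]]_n) : 'M[R[i]]_(n + m) :=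
  block_mx (shiftD a D) C B (shiftA a A).

(** The relation [S (1 - T) = a (1 + T)] between [S = D - C X] and its Cayley
    transform [T], together with [X S = B - A X], turns the defect of the two graph relations into an element
    of the kernel of the shifted block matrix. *)
Lemma invariant_graph_init m n a (A : 'M[R[i]]_m) B C (D : 'M[R[i]]_n)
    (s : doubling_iterate R m n) X (S := D - C *m X) :
  shifted_block a A B C D \in unitmx -> cayley_iterate a A B C D s ->
  riccati_solution A B C D X -> S + a%:M \in unitmx ->
  invariant_graph s X (invmx (S + a%:M) *m (S - a%:M)).
Proof.
case: s => E F G H Mu [/= DE DG AH AF] Xsol Su; set T := _ *m (S - _).
have ST : S *m T + a *: T = S - a%:M.
  by rewrite -mul_scalar_mx -mulmxDl mulKVmx.
have BAX : B - A *m X = X *m S.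
  move: Xsol => /eqP; rewrite -addrA addrC addr_eq0 opprB => /eqP.
  by rewrite addrC => ->; rewrite mulmxBr mulmxA.
have SE : S = D - C *m X by [].
clearbody T S.
pose P := E + G *m X *m T - T.
pose Y := H + F *m X *m T - X.
have PY0 : shifted_block a A B C D *m col_mx P Y = 0.
  have regroup p (U : 'M[R[i]]_(p, n)) (U' : 'M[R[i]]_(p, m)) :
      U *m P + U' *m Y = (U *m E + U' *m H) +
        (U *m G + U' *m F) *m X *m T - U *m T - U' *m X.
    rewrite /P /Y !mulmxDr !mulmxN !mulmxA.
    rewrite [LHS]addrACA [X in X + _]addrACA.
    by rewrite -!mulmxDl addrA.
  rewrite mul_block_col -col_mx0 !regroup DE DG AH AF /shiftD /shiftA.
  congr col_mx.
    have -> : D - a%:M + C *m X *m T - (D + a%:M) *m T - C *m X =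
        (S - a%:M) - (S *m T + a *: T).
      rewrite SE mulmxBl mulmxDl mul_scalar_mx.
      move: (C *m X *m T) (D *m T) (a *: T) (C *m X) => x y z u.
      by apply/matrixP => i j; rewrite !mxE; ring.
    by rewrite ST subrr.
  have -> : B + (A - a%:M) *m X *m T - B *m T - (A + a%:M) *m X =
      X *m (S - a%:M) - X *m (S *m T + a *: T).
    rewrite mulmxBr mulmxDr mulmxA -BAX mul_mx_scalar -scalemxAr.
    rewrite !mulmxBl !mulmxDl !mul_scalar_mx -scalemxAl.
    move: (A *m X *m T) (a *: (X *m T)) (B *m T) (A *m X) (a *: X) => x y z u w.
    by apply/matrixP => i j; rewrite !mxE; ring.
  by rewrite ST subrr.
have : col_mx P Y = 0 by rewrite -(mulKmx Mu (col_mx P Y)) PY0 mulmx0.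
rewrite -col_mx0 => /eq_col_mx [P0 Y0].
by split; apply/eqP; rewrite -subr_eq0; apply/eqP.
Qed.

(** The two Schur complements come from eliminating one of the two outgoing waves
    from the block system. *)
Lemma doubling_init_cayley m n a (A : 'M[R[i]]_m) B C (D : 'M[R[i]]_n) :
  shiftA a A \in unitmx -> shiftD a D \in unitmx ->
  schurW a a A B C D \in unitmx -> schurV a a A B C D \in unitmx ->
  cayley_iterate a A B C D (doubling_init a a A B C D).
Proof.
move=> Au Du Wu Vu; rewrite /cayley_iterate /doubling_init /=.
set Aa := shiftA a A in Au *; set Da := shiftD a D in Du *.
set W := schurW _ _ _ _ _ _ in Wu *; set V := schurV _ _ _ _ _ _ in Vu *.
(* The push-through identity links the two Schur complements. *)
have push : invmx W *m B *m invmx Da = invmx Aa *m B *m invmx V.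
  have WV : W *m invmx Aa *m B = B *m invmx Da *m V.
    rewrite /W /V /schurW /schurV -/Aa -/Da mulmxBl mulmxBr.
    by rewrite !mulmxBl mulmxV // mul1mx mulmxKV // !mulmxA.
  have WBV : invmx W *m B *m invmx Da *m V = invmx Aa *m B.
    by rewrite -!mulmxA (mulmxA B) -WV -mulmxA mulKmx.
  by rewrite -WBV mulmxK.
have VV : Da *m invmx V - C *m (invmx Aa *m B *m invmx V) = 1%:M.
  by rewrite !mulmxA -mulmxBl mulmxV.
have WW : Aa *m invmx W - B *m (invmx Da *m C *m invmx W) = 1%:M.
  by rewrite !mulmxA -mulmxBl mulmxV.
have DaB : Da - (a + a) *: 1%:M = D - a%:M.
  by rewrite scalemx1 raddfD opprD addrA addrK.
have AaB : Aa - (a + a) *: 1%:M = A - a%:M.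
  by rewrite scalemx1 raddfD opprD addrA addrK.
split; rewrite ?push mulmxBr mulmx1 -!scalemxAr.
- by rewrite -DaB -VV scalerBr opprB addrA addrAC.
- by rewrite !mulmxA mulmxV // mul1mx addrC subrK.
- by rewrite !mulmxA mulmxV // mul1mx subrK.
- by rewrite -AaB -WW scalerBr opprB addrC addrAC -addrA.
Qed.

Lemma schurW_unit m n a (A : 'M[R[i]]_m) B C (D : 'M[R[i]]_n) :
  shiftD a D \in unitmx -> shifted_block a A B C D \in unitmx ->
  schurW a a A B C D \in unitmx.
Proof.
move=> Du Mu; apply: unitmx_inj => X WX0.
pose Y := - (invmx (shiftD a D) *m C *m X).
have MYX : shifted_block a A B C D *m col_mx Y X = 0.
  rewrite mul_block_col -col_mx0; congr col_mx.
    by rewrite /Y mulmxN !mulmxA mulmxV // mul1mx addNr.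
  by rewrite -[RHS]WX0 /Y /schurW mulmxBl mulmxN !mulmxA addrC.
have : col_mx Y X = 0 by rewrite -(mulKmx Mu (col_mx Y X)) MYX mulmx0.
by rewrite -col_mx0 => /eq_col_mx [].
Qed.

End Initialization.

Section Dominance.
Context (R : realType).

Lemma offdiag_sum_shift n (a : R[i]) (M : 'M[R[i]]_n) i :
  offdiag_sum (M + a%:M) i = offdiag_sum M i.
Proof.
by apply: eq_bigr => j ji; rewrite !mxE eq_sym (negbTE ji) mulr0n addr0.
Qed.

Lemma row_sum_diag n (M : 'M[R[i]]_n) i :
  row_sum M i = cmod (M i i) + offdiag_sum M i.
Proof. by rewrite /row_sum (bigD1 i). Qed.

Lemma offdiag_sum_block_l n m (D : 'M[R[i]]_n) (C : 'M[R[i]]_(n, m))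
    (B : 'M[R[i]]_(m, n)) (A : 'M[R[i]]_m) i :
  offdiag_sum (block_mx D C B A) (lshift m i) = offdiag_sum D i + row_sum C i.
Proof.
rewrite /offdiag_sum big_split_ord /=; congr (_ + _).
  apply: eq_big => [j|j _]; first by rewrite eq_lshift.
  by rewrite block_mxEul.
by apply: eq_big => [j|j _]; rewrite ?eq_rlshift // block_mxEur.
Qed.

Lemma offdiag_sum_block_r n m (D : 'M[R[i]]_n) (C : 'M[R[i]]_(n, m))
    (B : 'M[R[i]]_(m, n)) (A : 'M[R[i]]_m) i :
  offdiag_sum (block_mx D C B A) (rshift n i) = offdiag_sum A i + row_sum B i.
Proof.
rewrite /offdiag_sum big_split_ord /= addrC; congr (_ + _).
  apply: eq_big => [j|j _]; first by rewrite eq_rshift.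
  by rewrite block_mxEdr.
by apply: eq_big => [j|j _]; rewrite ?eq_lrshift // block_mxEdl.
Qed.

(** In each block row [[M, N]], the diagonal entry is so much closer to [a] than
    to [- a] that the Cayley transform decreases row sums. *)
Definition cayley_dominant n m (a : R[i]) (M : 'M[R[i]]_n) (N : 'M[R[i]]_(n, m)) :=
  forall i, cmod (M i i - a) + 2 * (offdiag_sum M i + row_sum N i) <
            cmod (M i i + a).

Lemma cayley_dominant_shift_unit n m a (M : 'M[R[i]]_n) (N : 'M[R[i]]_(n, m)) :
  cayley_dominant a M N -> shiftD a M \in unitmx.
Proof.
move=> MN; apply: diag_dominant_unitmx => i.
rewrite offdiag_sum_shift !mxE eqxx mulr1n; apply: le_lt_trans (MN i).
have := row_sum_ge0 N i; have := cmod_ge0 (M i i - a).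
have : 0 <= offdiag_sum M i by apply: sumr_ge0 => j _; exact: cmod_ge0.
lra.
Qed.

(** The rows of the right-hand side of the Cayley system are dominated by those of
    its matrix; off the diagonal the two agree, whence the factor 2 above. *)
Lemma shifted_block_dominant m n a (A : 'M[R[i]]_m) B C (D : 'M[R[i]]_n) :
  cayley_dominant a D C -> cayley_dominant a A B ->
  forall i, row_sum (block_mx (D - a%:M) C B (A - a%:M)) i <
    cmod (shifted_block a A B C D i i) - offdiag_sum (shifted_block a A B C D) i.
Proof.
move=> DC AB i; rewrite row_sum_diag /shifted_block /shiftA /shiftD.
case: (split_ordP i) => j ->.
  rewrite !block_mxEul !offdiag_sum_block_l -rmorphN !offdiag_sum_shift.
  rewrite !mxE eqxx !mulr1n; have := DC j; lra.
rewrite !block_mxEdr !offdiag_sum_block_r -rmorphN !offdiag_sum_shift.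
rewrite !mxE eqxx !mulr1n; have := AB j; lra.
Qed.

Lemma shifted_block_unit m n a (A : 'M[R[i]]_m) B C (D : 'M[R[i]]_n) :
  cayley_dominant a D C -> cayley_dominant a A B ->
  shifted_block a A B C D \in unitmx.
Proof.
move=> DC AB; apply: diag_dominant_unitmx => i; rewrite -subr_gt0.
exact: le_lt_trans (row_sum_ge0 _ _) (shifted_block_dominant DC AB i).
Qed.

Lemma diag_dominant_contraction p q (M : 'M[R[i]]_p) (S N : 'M[R[i]]_(p, q)) :
  (forall i, row_sum N i < cmod (M i i) - offdiag_sum M i) ->
  M *m S = N -> rnorm S < 1.
Proof.
move=> MN MSN; pose d i := cmod (M i i) - offdiag_sum M i.
have d0 i : 0 < d i by exact: le_lt_trans (row_sum_ge0 N i) (MN i).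
pose c := \big[Order.max/0]_i (row_sum N i / d i).
apply: (@le_lt_trans _ _ c).
  apply: (diag_dominant_rnorm (M := M) _ _ MSN) => [|i|i].
  - exact: bigmax_ge_id.
  - by rewrite -subr_gt0; exact: d0.
  - by rewrite -ler_pdivrMr ?d0 //; exact: le_bigmax.
by apply: bigmax_lt => // i _; rewrite ltr_pdivrMr ?d0 // mul1r.
Qed.

Lemma cayley_iterate_contractive m n a (A : 'M[R[i]]_m) B C (D : 'M[R[i]]_n) s :
  cayley_dominant a D C -> cayley_dominant a A B -> cayley_iterate a A B C D s ->
  exists c, [/\ 0 <= c, c < 1 & contractive c s].
Proof.
move=> DC AB [DE DG AH AF].
pose S := block_mx (dE s) (dG s) (dH s) (dF s); exists (rnorm S).
split; first exact: rnorm_ge0.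
  apply: diag_dominant_contraction (shifted_block_dominant DC AB) _.
  by rewrite mulmx_block DE DG AH AF.
by rewrite /S /block_mx rnorm_col_mx; split; rewrite le_max lexx ?orbT.
Qed.

Lemma sda_init m n a (A : 'M[R[i]]_m) B C (D : 'M[R[i]]_n) :
  cayley_dominant a D C -> cayley_dominant a A B ->
  [/\ shiftA a A \in unitmx, shiftD a D \in unitmx,
      schurW a a A B C D \in unitmx & schurV a a A B C D \in unitmx].
Proof.
move=> DC AB; have Du := cayley_dominant_shift_unit DC.
have Au := cayley_dominant_shift_unit AB; split; [exact: Au|exact: Du| |].
  exact: schurW_unit Du (shifted_block_unit DC AB).
exact: (@schurW_unit _ _ _ a D C B A Au (shifted_block_unit AB DC)).
Qed.

Lemma cayley_quadratic_cvg m n a (A : 'M[R[i]]_m) B C (D : 'M[R[i]]_n) s X :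
  a != 0 -> cayley_dominant a D C -> cayley_dominant a A B ->
  cayley_iterate a A B C D s -> riccati_solution A B C D X ->
  (forall la, eigenvalue (D - C *m X) la -> cmod (la - a) < cmod (la + a)) ->
  quadratic_cvg (fun k => dH (iter k (@doubling_step R m n) s)) X.
Proof.
move=> a0 DC AB sabcd Xsol Xspec.
have [c [c0 c1 sc]] := cayley_iterate_contractive DC AB sabcd.
have sX := invariant_graph_init (shifted_block_unit DC AB) sabcd Xsol
  (cayley_unit Xspec).
apply: (doubling_quadratic_cvg c0 c1 sc sX) => mu.
exact: cayley_eigenvalue.
Qed.

End Dominance.

(** * The choice of the shift *)

Section Shift.
Context (R : realType) (omega : R).

Lemma cmod_add_shift (t : R) (z : R[i]) (alpha := Complex t 0 * z_perp omega) :
  cmod (z + alpha) ^+ 2 = cmod (z - alpha) ^+ 2 + 4 * t * omega_re omega z.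
Proof.
rewrite !sqr_cmod /alpha; case: z => x y; rewrite /omega_re /z_perp.
by simpc => /=; ring.
Qed.

Lemma omega_re_gt0_shift (t : R) (z : R[i]) (alpha := Complex t 0 * z_perp omega) :
  0 < t -> 0 < omega_re omega z -> cmod (z - alpha) < cmod (z + alpha).
Proof.
move=> t0 z0; rewrite -ltr_sqr ?nnegrE ?cmod_ge0 // cmod_add_shift ltrDl.
by rewrite !mulr_gt0.
Qed.

(** In the coordinates rotated by [z_perp], where [z] becomes [(x, y)] and
    [alpha] becomes [(s, 0)] with [s = varpi t], the points [z] with
    [|z + alpha| - |z - alpha| > 2 q] form the inside of a branch of a hyperbola
    with foci [(- s, 0)] and [(s, 0)]; with [b = varpi q ^ 2], this inside is
    given by [(s ^ 2 - b) (x ^ 2 - b) > b y ^ 2].  Since [b <= q ^ 2 < x ^ 2],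
    the bound [tau < t] is more than enough. *)
Lemma tau_dominance k (Q : 'M[R[i]]_k) (t : R) i
    (alpha := Complex t 0 * z_perp omega) :
  0 <= omega -> omega <= 1 -> offdiag_sum Q i < omega_re omega (Q i i) ->
  tau omega Q i < t ->
  cmod (Q i i - alpha) + 2 * offdiag_sum Q i < cmod (Q i i + alpha).
Proof.
move=> om0 om1; rewrite /tau; set w := omega ^+ 2 + _; set q := offdiag_sum Q i.
set x := omega_re _ _; set y := omega_im _ _ => qx taut.
have q0 : 0 <= q by apply: sumr_ge0 => j _; exact: cmod_ge0.
have w0 : 0 < w by rewrite /w; nra.
have w1 : w <= 1 by rewrite /w; nra.
have xq : 0 < x - q by rewrite subr_gt0.
have x0 : 0 < x by exact: le_lt_trans qx.
pose s := w * t; pose arg := q * (x + y ^+ 2 / (x - q)).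
have arg0 : 0 <= arg.
  by rewrite mulr_ge0 // addr_ge0 ?(ltW x0) // divr_ge0 ?sqr_ge0 // ltW.
have args : Num.sqrt arg < s by rewrite -ltr_pdivrMl.
have s0 : 0 < s by exact: le_lt_trans (sqrtr_ge0 _) args.
have sarg : arg < s ^+ 2.
  by rewrite -(sqr_sqrtr arg0) ltr_sqr // nnegrE ?sqrtr_ge0 // ltW.
have sq : q * x * (x - q) + q * y ^+ 2 < s ^+ 2 * (x - q).
  rewrite -subr_gt0 (_ : _ - _ = (s ^+ 2 - arg) * (x - q)) ?mulr_gt0 ?subr_gt0 //.
  by rewrite /arg; field; rewrite gt_eqF.
have y20 : 0 <= y ^+ 2 by exact: sqr_ge0.
have qxs : q * x < s ^+ 2.
  rewrite -(ltr_pM2r xq); apply: le_lt_trans sq; rewrite lerDl.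
  exact: mulr_ge0.
have qqx : q ^+ 2 <= q * x by rewrite expr2 ler_wpM2l // ltW.
have sxq : q ^+ 2 * y ^+ 2 < (s ^+ 2 - q ^+ 2) * (x ^+ 2 - q ^+ 2).
  have xDq : 0 < x + q by rewrite ltr_wpDr.
  have h1 : 0 < (x + q) * (s ^+ 2 * (x - q) - (q * x * (x - q) + q * y ^+ 2)).
    by rewrite mulr_gt0 // subr_gt0.
  have h2 : 0 <= (q * x - q ^+ 2) * ((x - q) * (x + q)).
    by rewrite !mulr_ge0 ?subr_ge0 // ltW.
  have h3 : 0 <= q * x * y ^+ 2 by exact: mulr_ge0 (mulr_ge0 q0 (ltW x0)) y20.
  lra.
pose b := w * q ^+ 2.
have b0 : 0 <= b by rewrite mulr_ge0 ?sqr_ge0 // ltW.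
have bq : b <= q ^+ 2 by rewrite ler_piMl ?sqr_ge0.
have xq2 : q ^+ 2 < x ^+ 2 by rewrite ltr_sqr // nnegrE // ltW.
have hyperbola : b * y ^+ 2 < (s ^+ 2 - b) * (x ^+ 2 - b).
  apply: (@le_lt_trans _ _ (q ^+ 2 * y ^+ 2)).
    by rewrite ler_wpM2r.
  apply: lt_le_trans sxq _; apply: ler_pM; rewrite ?subr_ge0 ?lerB //.
    by apply: le_trans qqx _; exact: ltW.
  exact: ltW.
have bsx : b < s * x.
  have : b ^+ 2 < (s * x) ^+ 2.
    rewrite (exprMn _ s) (expr2 b); apply: ltr_pM => //; apply: le_lt_trans bq _ => //.
    exact: le_lt_trans qxs.
  by rewrite ltr_sqr // nnegrE // mulr_ge0 // ltW.
have wv : w * cmod (Q i i - alpha) ^+ 2 = (x - s) ^+ 2 + y ^+ 2.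
  rewrite sqr_cmod /x /y /s /w /alpha; case: (Q i i) => x' y'.
  by rewrite /omega_re /omega_im /z_perp; simpc => /=; ring.
have uv : cmod (Q i i + alpha) ^+ 2 = cmod (Q i i - alpha) ^+ 2 + 4 * t * x.
  exact: cmod_add_shift.
move: (cmod_ge0 (Q i i - alpha)) (cmod_ge0 (Q i i + alpha)) wv uv.
move: (cmod (Q i i - alpha)) (cmod (Q i i + alpha)) => v u v0 u0 wv uv.
have qv : q * v < t * x - q ^+ 2.
  rewrite -(ltr_pM2l w0) mulrBr (mulrA w q) (mulrA w t) -/s -/b -ltr_sqr.
  - have -> : (w * q * v) ^+ 2 = b * ((x - s) ^+ 2 + y ^+ 2).
      by rewrite -wv /b; ring.
    lra.
  - by rewrite nnegrE !mulr_ge0 // ltW.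
  - by rewrite nnegrE subr_ge0 ltW.
rewrite -ltr_sqr ?nnegrE // ?addr_ge0 ?mulr_ge0 // uv; lra.
Qed.

End Shift.

(** * Convergence of the doubling algorithm *)

Theorem theorem6p10 (R : realType) (m n : nat) (m_gt0 : (0 < m)%N)
    (n_gt0 : (0 < n)%N) (omega : R)
    (omega_ge0 : 0 <= omega) (omega_le1 : omega <= 1)
    (A : 'M[R[i]]_m) (B : 'M[R[i]]_(m, n)) (C : 'M[R[i]]_(n, m))
    (D : 'M[R[i]]_n)
    (hclass : class_H omega A B C D)
    (hones : positive_vec
       (omega_comparison omega (riccati_mx A B C D) *m const_mx 1))
    (Phi : 'M[R[i]]_(m, n)) (Psi : 'M[R[i]]_(n, m))
    (hPhi : extremal_solution omega A B C D Phi)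
    (hPsi : extremal_solution omega D C B A Psi)
    (t : R)
    (ht : forall i : 'I_(n + m), tau omega (riccati_mx A B C D) i < t) :
  let alpha := Complex t 0 * z_perp omega in
  [/\ sda_well_defined alpha A B C D,
      quadratic_cvg (fun k => dH (sda alpha A B C D k)) Phi &
      quadratic_cvg (fun k => dG (sda alpha A B C D k)) Psi].
Proof.
set alpha := _ * _; move=> /=.
(* Row [i] of [hones] says that [omega_re] of the diagonal entry exceeds [q_i]. *)
have dom i : cmod (riccati_mx A B C D i i - alpha) +
    2 * offdiag_sum (riccati_mx A B C D) i < cmod (riccati_mx A B C D i i + alpha).
  apply: tau_dominance (ht i) => //.
  rewrite -subr_gt0; suff -> : omega_re omega (riccati_mx A B C D i i) -
    offdiag_sum (riccati_mx A B C D) i =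
    (omega_comparison omega (riccati_mx A B C D) *m
      (const_mx 1 : 'cV[R]_(n + m))) i 0 by exact: hones.
  rewrite [RHS]mxE (bigD1 i) //= !mxE eqxx mulr1; congr (_ + _).
  rewrite -sumrN; apply: eq_bigr => j ji.
  by rewrite !mxE eq_sym (negbTE ji) mulr1.
have row_sumN p q (M : 'M[R[i]]_(p, q)) i : row_sum (- M) i = row_sum M i.
  by apply: eq_bigr => j _; rewrite mxE cmodN.
have DC : cayley_dominant alpha D C.
  move=> i; have := dom (lshift m i).
  by rewrite /riccati_mx block_mxEul offdiag_sum_block_l row_sumN.
have AB : cayley_dominant alpha A B.
  move=> i; have := dom (rshift n i).
  by rewrite /riccati_mx block_mxEdr offdiag_sum_block_r row_sumN.
have [Au Du Wu Vu] := sda_init DC AB.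
have s0 := doubling_init_cayley Au Du Wu Vu.
have t0 : 0 < t.
  apply: le_lt_trans (ht (lshift m (Ordinal n_gt0))).
  by rewrite mulr_ge0 ?sqrtr_ge0 // invr_ge0 addr_ge0 ?sqr_ge0.
have alpha0 : alpha != 0.
  apply/eqP => a0.
  have z0 : 0 < omega_re omega (z_perp omega) by rewrite /omega_re /=; nra.
  by have := omega_re_gt0_shift t0 z0; rewrite -/alpha a0 addr0 subr0 ltxx.
have [Phi_sol Phi_spec] := hPhi; have [Psi_sol Psi_spec] := hPsi.
split.
- split=> // k; have [c [c0 c1 sc]] := cayley_iterate_contractive DC AB s0.
  exact: contractive_iter_unit k c0 c1 sc.
- apply: (cayley_quadratic_cvg alpha0 DC AB s0 Phi_sol) => la /Phi_spec.
  exact: omega_re_gt0_shift.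
- have swap_iter k : swap (sda alpha A B C D k) =
      iter k (@doubling_step R n m) (swap (doubling_init alpha alpha A B C D)).
    by elim: k => //= k <-; rewrite doubling_step_swap.
  have := cayley_quadratic_cvg alpha0 AB DC (cayley_iterate_swap s0) Psi_sol
    (fun la la_eig => omega_re_gt0_shift t0 (Psi_spec la la_eig)).
  have -> // : (fun k => dG (sda alpha A B C D k)) = (fun k => dH
      (iter k (@doubling_step R n m) (swap (doubling_init alpha alpha A B C D)))).
  by apply/funext => k; rewrite -swap_iter.
Qed.
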